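(* Let $S$ be a semigroup with weak local units and $\beta=({}_SA,B_S)$ a dual pair over $S$. Then the Morita semigroup $B\otimes_S^\beta A$ is isomorphic to the semigroup $\Sigma^\beta$.
   Context: A left $S$-act ${}_SA$ is a set $A$ with a map $S\times A\to A$ satisfying $(st)a=s(ta)$; right acts are defined dually. $\mathrm{End}({}_SA)$ and $\mathrm{End}(B_S)$ denote the monoids of act endomorphisms. For a right $S$-act $B_S$ and a left $S$-act ${}_SA$, the tensor product $B\otimes_S A$ is the quotient of the set $B\times A$ by the smallest equivalence relation identifying $(bs,a)$ with $(b,sa)$ for all $b\in B$, $s\in S$, $a\in A$; the class of $(b,a)$ is $b\otimes a$. A semigroup $S$ has weak local units if for every $s\in S$ there exist $u,v\in S$ such that $us=s=sv$. A pair $\beta=({}_SA,B_S)$ over $S$ consists of a left act ${}_SA$, a right act $B_S$ and an $(S,S)$-biact morphism $\langle\,,\rangle:{}_SA\times B_S\to{}_SS_S$, i.e. $\langle sa,b\rangle=s\langle a,b\rangle$ and $\langle a,bs\rangle=\langle a,b\rangle s$. The pair is dual if (1) for every $a\in A$ there exists $a'\in A$ with $a\in Sa'$ and $\langle a',B\rangle=S$; and (2) for every $b\in B$ there exists $b'\in B$ with $b\in b'S$ and $\langle A,b'\rangle=S$. The Morita semigroup $B\otimes_S^\beta A$ is the set $B\otimes_S A$ with multiplication $(b\otimes a)(b'\otimes a')=b\otimes\langle a,b'\rangle a'$. Define $$\Omega^\beta=\{(\rho,\sigma)\mid\rho\in\mathrm{End}({}_SA),\ \sigma\in\mathrm{End}(B_S),\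 \langle\rho(a),b\rangle=\langle a,\sigma(b)\rangle\text{ for all }a\in A,\ b\in B\},$$ with multiplication $(f,g)(f',g')=(f'f,gg')$, where $f'f$ is the composite $x\mapsto f'(f(x))$ and $gg'$ the composite $y\mapsto g(g'(y))$, and $$\Sigma^\beta=\{(\rho,\sigma)\in\Omega^\beta\mid\exists b\in B,\ \exists a\in A:\ \rho=\langle -,b\rangle a\text{ and }\sigma=b\langle a,-\rangle\},$$ which is a subsemigroup of $\Omega^\beta$. *)

(* Defs.v *)
From HB Require Import structures.
From Stdlib Require Import Relation_Operators.
From mathcomp Require Import all_boot monoid generic_quotient.
From mathcomp Require Import boolp classical_sets.

Set Implicit Arguments.
Unset Strict Implicit.
Unset Printing Implicit Defensive.

Local Open Scope group_scope.
Local Open Scope quotient_scope.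
Local Open Scope classical_set_scope.

Reserved Notation "s *l a" (at level 40, left associativity).
Reserved Notation "b *r s" (at level 40, left associativity).

Definition weak_local_units (S : semigroupType) : Prop :=
  forall s : S, exists u v : S, u * s = s /\ s = s * v.

HB.mixin Record isLeftAct (S : semigroupType) (A : Type) := {
  lact : S -> A -> A;
  lactM : forall (s t : S) (a : A), lact (s * t) a = lact s (lact t a)
}.

#[short(type="leftActType")]
HB.structure Definition LeftAct (S : semigroupType) := {A of isLeftAct S A}.

HB.mixin Record isRightAct (S : semigroupType) (B : Type) := {
  ract : B -> S -> B;
  ractM : forall (b : B) (s t : S), ract b (s * t) = ract (ract b s) t
}.

#[short(type="rightActType")]
HB.structure Definition RightAct (S : semigroupType) := {B of isRightAct S B}.

Notation "s *l a" := (lact s a).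
Notation "b *r s" := (ract b s).

Record lact_end (S : semigroupType) (A : leftActType S) := LactEnd {
  lact_end_fun :> A -> A;
  lact_endM : forall (s : S) (a : A), lact_end_fun (s *l a) = s *l lact_end_fun a
}.

Record ract_end (S : semigroupType) (B : rightActType S) := RactEnd {
  ract_end_fun :> B -> B;
  ract_endM : forall (b : B) (s : S), ract_end_fun (b *r s) = ract_end_fun b *r s
}.

Lemma lact_end_eq (S : semigroupType) (A : leftActType S) (f g : lact_end A) :
  f =1 g -> f = g.
Proof.
case: f g => [f fM] [g gM] /= /funext fg; subst g.
by congr LactEnd; apply: Prop_irrelevance.
Qed.

Lemma ract_end_eq (S : semigroupType) (B : rightActType S) (f g : ract_end B) :
  f =1 g -> f = g.
Proof.
case: f g => [f fM] [g gM] /= /funext fg; subst g.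
by congr RactEnd; apply: Prop_irrelevance.
Qed.

Lemma lact_end_comp_subproof (S : semigroupType) (A : leftActType S)
  (f g : lact_end A) (s : S) (a : A) : (f \o g) (s *l a) = s *l (f \o g) a.
Proof. by rewrite /= !lact_endM. Qed.

Definition lact_end_comp (S : semigroupType) (A : leftActType S)
  (f g : lact_end A) : lact_end A := LactEnd (lact_end_comp_subproof f g).

Lemma ract_end_comp_subproof (S : semigroupType) (B : rightActType S)
  (f g : ract_end B) (b : B) (s : S) : (f \o g) (b *r s) = (f \o g) b *r s.
Proof. by rewrite /= !ract_endM. Qed.

Definition ract_end_comp (S : semigroupType) (B : rightActType S)
  (f g : ract_end B) : ract_end B := RactEnd (ract_end_comp_subproof f g).

Section Tensor.
Variables (S : semigroupType) (B : rightActType S) (A : leftActType S).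

Variant tensor_step : B * A -> B * A -> Prop :=
  TensorStep (b : B) (s : S) (a : A) : tensor_step (b *r s, a) (b, s *l a).

(* [clos_refl_sym_trans] is the smallest equivalence relation containing
   [tensor_step]; [{classic B * A}] is [B * A] with the classical choice
   structure that [{eq_quot _}] requires. *)
Definition tensor_rel : rel {classic B * A} :=
  fun x y => `[< clos_refl_sym_trans _ tensor_step x y >].

Lemma tensor_rel_refl : reflexive tensor_rel.
Proof. by move=> x; apply/asboolP; apply: rst_refl. Qed.

Lemma tensor_rel_sym : symmetric tensor_rel.
Proof. by move=> x y; apply/asboolP/asboolP; apply: rst_sym. Qed.

Lemma tensor_rel_trans : transitive tensor_rel.
Proof.
by move=> y x z /asboolP xy /asboolP yz; apply/asboolP; apply: rst_trans xy yz.
Qed.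

Canonical tensor_equiv :=
  EquivRel tensor_rel tensor_rel_refl tensor_rel_sym tensor_rel_trans.

Definition tensor := {eq_quot tensor_equiv}.

HB.instance Definition _ := Choice.on tensor.
HB.instance Definition _ := EqQuotient.on tensor.

Definition tens (b : B) (a : A) : tensor := \pi_tensor ((b, a) : {classic B * A}).

Lemma tens_act (b : B) (s : S) (a : A) : tens (b *r s) a = tens b (s *l a).
Proof. by apply/eqmodP/asboolP; apply: rst_step. Qed.

Lemma tensP (x : tensor) : tens (repr x).1 (repr x).2 = x.
Proof. by rewrite /tens -surjective_pairing reprK. Qed.

(* Universal property: balanced maps factor through the tensor product. *)
Lemma tens_repr (T : Type) (f : B -> A -> T) :
  (forall b s a, f (b *r s) a = f b (s *l a)) ->
  forall b a, f (repr (tens b a)).1 (repr (tens b a)).2 = f b a.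
Proof.
move=> fP b a; have /eqmodP/asboolP : repr (tens b a) = (b, a) %[mod tensor].
  by rewrite reprK.
move: (repr _) => x; rewrite -[RHS]/(f (b, a).1 (b, a).2).
by elim=> // [_ _ [] //|x' y' z' _ -> _ ->].
Qed.

End Tensor.

Record act_pair (S : semigroupType) (A : leftActType S) (B : rightActType S) :=
  ActPair {
    pairing :> A -> B -> S;
    pairing_lact : forall s a b, pairing (s *l a) b = s * pairing a b;
    pairing_ract : forall a b s, pairing a (b *r s) = pairing a b * s
  }.

Section PairTheory.
Variables (S : semigroupType) (A : leftActType S) (B : rightActType S).
Variable beta : act_pair A B.

Definition dual_pair : Prop :=
  (forall a : A, exists a' : A,
      (exists s : S, a = s *l a') /\ range (fun b => beta a' b) = [set: S]) /\
  (forall b : B, exists b' : B,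
      (exists s : S, b = b' *r s) /\ range (fun a => beta a b') = [set: S]).

(* The carrier does not depend on the pair, but the product does: the argument
   lets the semigroup structure be inferred from the type. *)
Definition morita of act_pair A B : Type := tensor B A.
HB.instance Definition _ := Choice.copy (morita beta) (tensor B A).

(* The product is computed on representatives; [morita_mulE] shows that it does
   not depend on them. *)
Definition morita_mul (x y : morita beta) : morita beta :=
  tens (repr x).1 (beta (repr x).2 (repr y).1 *l (repr y).2).

Lemma morita_mulE (b : B) (a : A) (b' : B) (a' : A) :
  morita_mul (tens b a) (tens b' a') = tens b (beta a b' *l a').
Proof.
rewrite /morita_mul.
rewrite (tens_repr (f := fun b1 a1 =>
  tens b1 (beta a1 (repr (tens b' a')).1 *l (repr (tens b' a')).2))); last first.
  by move=> b1 s a1; rewrite tens_act pairing_lact lactM.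
rewrite (tens_repr (f := fun b1 a1 => tens b (beta a b1 *l a1))) //.
by move=> b1 s a1; rewrite pairing_ract lactM.
Qed.

Lemma morita_mulA : associative morita_mul.
Proof.
move=> x y z; rewrite -(tensP x) -(tensP y) -(tensP z) !morita_mulE.
by rewrite pairing_lact lactM.
Qed.

HB.instance Definition _ := isSemigroup.Build (morita beta) morita_mulA.

Record Omega := MkOmega {
  Omega_l : lact_end A;
  Omega_r : ract_end B;
  Omega_adj : forall a b, beta (Omega_l a) b = beta a (Omega_r b)
}.

HB.instance Definition _ := gen_eqMixin Omega.
HB.instance Definition _ := gen_choiceMixin Omega.

Lemma Omega_eq (w w' : Omega) :
  Omega_l w =1 Omega_l w' -> Omega_r w =1 Omega_r w' -> w = w'.
Proof.
case: w w' => [f g fg] [f' g' fg'] /= /lact_end_eq ff' /ract_end_eq gg'.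
by subst f' g'; congr MkOmega; apply: Prop_irrelevance.
Qed.

Lemma Omega_mul_subproof (w w' : Omega) (a : A) (b : B) :
  beta (lact_end_comp (Omega_l w') (Omega_l w) a) b =
  beta a (ract_end_comp (Omega_r w) (Omega_r w') b).
Proof. by rewrite /= !Omega_adj. Qed.

Definition Omega_mul (w w' : Omega) : Omega :=
  MkOmega (Omega_mul_subproof w w').

Lemma Omega_mulA : associative Omega_mul.
Proof. by move=> w1 w2 w3; apply: Omega_eq. Qed.

HB.instance Definition _ := isSemigroup.Build Omega Omega_mulA.

Definition in_Sigma : {pred Omega} := fun w =>
  `[< exists (b : B) (a : A),
        (Omega_l w : A -> A) = (fun x => beta x b *l a) /\
        (Omega_r w : B -> B) = (fun y => b *r beta a y) >].

Lemma in_Sigma_mulg_closed : mulg_closed in_Sigma.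
Proof.
move=> w w' /asboolP[b [a [wl wr]]] /asboolP[b' [a' [wl' wr']]].
apply/asboolP; exists b, (beta a b' *l a'); split; apply/funext => x /=.
  by rewrite wl wl' pairing_lact lactM.
by rewrite wr wr' pairing_ract pairing_lact.
Qed.

Record Sigma := MkSigma {
  Sigma_val : Omega;
  Sigma_valP : in_Sigma Sigma_val
}.

HB.instance Definition _ := [isSub for Sigma_val].
HB.instance Definition _ := [Choice of Sigma by <:].
HB.instance Definition _ :=
  SubChoice_isSubSemigroup.Build Omega in_Sigma Sigma in_Sigma_mulg_closed.

End PairTheory.

(* Main.v *)
Require Import Defs.
From HB Require Import structures.
From mathcomp Require Import all_boot monoid.
From mathcomp Require Import boolp classical_sets.

(** The isomorphism sends b ⊗ a to (⟨-, b⟩a, b⟨a, -⟩). It is visibly a morphism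
    onto Sigma.  For injectivity, duality and weak local units give y, a1 with
    a = ⟨a, y⟩a1 and x, b1 with b' = b1⟨x, b'⟩; if b ⊗ a and b' ⊗ a' have the
    same image, then b ⊗ a = b⟨a, y⟩ ⊗ a1 = b'⟨a', y⟩ ⊗ a1
    = b1 ⊗ ⟨⟨x, b'⟩a', y⟩a1 = b1 ⊗ ⟨⟨x, b⟩a, y⟩a1 = b1 ⊗ ⟨x, b⟩a
    = b1 ⊗ ⟨x, b'⟩a' = b' ⊗ a'. *)

Set Implicit Arguments.
Unset Strict Implicit.
Unset Printing Implicit Defensive.

Local Open Scope group_scope.

Section MoritaSigma.
Variables (S : semigroupType) (A : leftActType S) (B : rightActType S).
Variable beta : act_pair A B.

(** If a = s a1 with ⟨a1, B⟩ = S, a right local unit v of s can be written ⟨a1, y⟩; then ⟨a, y⟩ =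
    s⟨a1, y⟩ = sv = s. *)
Lemma dual_pair_decl (a : A) : weak_local_units S -> dual_pair beta ->
  exists (y : B) (a1 : A), a = beta a y *l a1.
Proof.
move=> hS [/(_ a)[a1 [[s as_] a1S]] _].
have [_ [v [_ sv]]] := hS s.
have [y _ yv] : range (fun b => beta a1 b) v by rewrite a1S.
by exists y, a1; rewrite {2}as_ pairing_lact yv -sv.
Qed.

(** Mirror image: a left local unit u of s is realised as ⟨x, b1⟩. *)
Lemma dual_pair_decr (b : B) : weak_local_units S -> dual_pair beta ->
  exists (x : A) (b1 : B), b = b1 *r beta x b.
Proof.
move=> hS [_ /(_ b)[b1 [[s bs] b1S]]].
have [u [_ [us _]]] := hS s.
have [x _ xu] : range (fun a => beta a b1) u by rewrite b1S.
by exists x, b1; rewrite {2}bs pairing_ract xu us.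
Qed.

Lemma rank1_lM (b : B) (a : A) (s : S) (x : A) :
  beta (s *l x) b *l a = s *l (beta x b *l a).
Proof. by rewrite pairing_lact lactM. Qed.

Lemma rank1_rM (b : B) (a : A) (y : B) (s : S) :
  b *r beta a (y *r s) = b *r beta a y *r s.
Proof. by rewrite pairing_ract ractM. Qed.

Definition rank1_l (b : B) (a : A) : lact_end A := LactEnd (rank1_lM b a).
Definition rank1_r (b : B) (a : A) : ract_end B := RactEnd (rank1_rM b a).

Lemma rank1_adj (b : B) (a x : A) (y : B) :
  beta (rank1_l b a x) y = beta x (rank1_r b a y).
Proof. by rewrite /= pairing_lact pairing_ract. Qed.

Definition rank1 (b : B) (a : A) : Omega beta := MkOmega (rank1_adj b a).

Lemma rank1_in_Sigma (b : B) (a : A) : in_Sigma (rank1 b a).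
Proof. by apply/asboolP; exists b, a. Qed.

Definition sigma_of (b : B) (a : A) : Sigma beta :=
  MkSigma (rank1_in_Sigma b a).

(** This is what lets [sigma_of] descend to the tensor product. *)
Lemma sigma_of_balanced (b : B) (s : S) (a : A) :
  sigma_of (b *r s) a = sigma_of b (s *l a).
Proof.
apply/val_inj/Omega_eq => x /=; first by rewrite pairing_ract lactM.
by rewrite pairing_lact ractM.
Qed.

(** Left components compose in reverse order in [Omega], which matches ⟨⟨x, b⟩a, b'⟩a' = ⟨x, b⟩⟨a,
    b'⟩a'. *)
Lemma sigma_ofM (b : B) (a : A) (b' : B) (a' : A) :
  sigma_of b (beta a b' *l a') = sigma_of b a * sigma_of b' a'.
Proof.
apply/val_inj/Omega_eq => x /=; first by rewrite pairing_lact lactM.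
by rewrite pairing_lact pairing_ract.
Qed.

Definition morita_sigma (z : morita beta) : Sigma beta :=
  sigma_of (repr z).1 (repr z).2.

Lemma morita_sigmaE (b : B) (a : A) :
  morita_sigma (tens b a) = sigma_of b a.
Proof. exact/tens_repr/sigma_of_balanced. Qed.

Lemma morita_sigmaM : {morph morita_sigma : x y / x * y}.
Proof.
move=> x y; rewrite -(tensP x) -(tensP y).
by rewrite [_ * _]morita_mulE !morita_sigmaE sigma_ofM.
Qed.

HB.instance Definition _ :=
  isMultiplicative.Build (morita beta) (Sigma beta) morita_sigma morita_sigmaM.

Lemma morita_sigma_surj (w : Sigma beta) : exists z, morita_sigma z = w.
Proof.
case: w => w wS; have /asboolP[b [a [wl wr]]] := wS.
exists (tens b a); rewrite morita_sigmaE.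
(* Only the two underlying functions need comparing; [wl] settles one goal and [wr] the other. *)
by apply/val_inj/Omega_eq => x /=; rewrite ?wl ?wr.
Qed.

Lemma sigma_of_inj (b b' : B) (a a' : A) :
  weak_local_units S -> dual_pair beta ->
  sigma_of b a = sigma_of b' a' -> tens b a = tens b' a'.
Proof.
move=> hS hbeta eq_s.
have eql x : beta x b *l a = beta x b' *l a'.
  exact: (congr1 (fun w => Omega_l (Sigma_val w) x) eq_s).
have eqr y : b *r beta a y = b' *r beta a' y.
  exact: (congr1 (fun w => Omega_r (Sigma_val w) y) eq_s).
have [y [a1 ya]] := dual_pair_decl a hS hbeta.
have [x [b1 xb']] := dual_pair_decr b' hS hbeta.
(* Here [eqr] at y trades b, a for b', a' across the tensor sign. Afterwards [eql] at x is used
   twice: backwards to recover a from a1, then forwards to reach a'. *)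
have -> : tens b a = tens b1 (beta (beta x b' *l a') y *l a1).
  by rewrite {1}ya -tens_act eqr tens_act {1}xb' tens_act pairing_lact lactM.
by rewrite -eql pairing_lact lactM -ya eql -tens_act -xb'.
Qed.

Lemma morita_sigma_inj :
  weak_local_units S -> dual_pair beta -> injective morita_sigma.
Proof.
move=> hS hbeta z z' eq_zz'; rewrite -(tensP z) -(tensP z').
exact: sigma_of_inj.
Qed.

End MoritaSigma.

Theorem theorem3p8 (S : semigroupType) (A : leftActType S) (B : rightActType S)
    (beta : act_pair A B)
    (hS : weak_local_units S) (hbeta : dual_pair beta) :
  exists f : {multiplicative morita beta -> Sigma beta}, bijective f.
Proof.
exists (@morita_sigma S A B beta).
(* A chosen section g is a right inverse; injectivity makes it two-sided. *)
have [g gK] := choice (@morita_sigma_surj S A B beta).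
exists g => //; exact: inj_can_sym gK (morita_sigma_inj hS hbeta).
Qed.
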